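(* Let $\mathfrak{H}$ be the complex Heisenberg Lie algebra with basis $\{z_i:i\in\mathbb{Z}\}$ and bracket $[z_i,z_j]=j\delta_{i,-j}z_0$, and let $\mathfrak{n}_+$ be the span of the $z_i$ with $i>0$. Let $$I=\{\varepsilon=(\varepsilon_1,\varepsilon_2,\dots):\varepsilon_i\in\mathbb{N};\ \varepsilon_i=2\text{ for all but finitely many } i\}$$ and let $V$ be the complex vector space with basis $\{v_\varepsilon:\varepsilon\in I\}$. For $i\in\mathbb{Z}$ and $\varepsilon\in I$ set $$z_i v_\varepsilon=\begin{cases} v_\varepsilon, & i=0;\\ 0, & i>0\text{ and }\varepsilon_i=1;\\ v_{(\varepsilon_1,\dots,\varepsilon_{i-1},\varepsilon_i-1,\varepsilon_{i+1},\varepsilon_{i+2},\dots)}, & i>0\text{ and }\varepsilon_i>1;\\ i\,\varepsilon_{-i}\,v_{(\varepsilon_1,\dots,\varepsilon_{-i-1},\varepsilon_{-i}+1,\varepsilon_{-i+1},\varepsilon_{-i+2},\dots)}, & i<0.\end{cases}$$ Then these formulas make $V$ into a simple $\mathfrak{H}$-module on which every $z_i$ with $i>0$ acts locally nilpotently, while every nonzero vector of $V$ generates an infinite-dimensional $\mathfrak{n}_+$-submodule. In particular, $V$ contains no nonzero vector $v$ with $\mathfrak{n}_+v=0$, and $V$ is not a highest weight module.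
   Context: $\mathbb{N}$ denotes the set of positive integers. An element $x$ acts locally nilpotently on $V$ if for every $v\in V$ there is $m\in\mathbb{N}$ with $x^mv=0$. A highest weight $\mathfrak{H}$-module is one generated by a nonzero vector $v$ such that $\mathfrak{n}_+v=0$ and $z_0v=\lambda v$ for some $\lambda\in\mathbb{C}$. *)

(* Defs.v *)
From HB Require Import structures.
From mathcomp Require Import all_boot all_order all_algebra.
From mathcomp Require Import finmap complex reals.
From mathcomp.multinomials Require Import monalg.

Set Implicit Arguments.
Unset Strict Implicit.
Unset Printing Implicit Defensive.

Import Order.TTheory GRing.Theory Num.Theory.
Local Open Scope ring_scope.
Local Open Scope complex_scope.

HB.mixin Record Lmodule_isLieAlgebra (K : fieldType) L of GRing.Lmodule K L := {
  lie : L -> L -> L;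
  lie_linearl : forall y, linear (fun x => lie x y);
  lie_linearr : forall x, linear (lie x);
  liexx : forall x, lie x x = 0;
  lie_jacobi : forall x y z,
    lie x (lie y z) + lie y (lie z x) + lie z (lie x y) = 0
}.

#[short(type="lieAlgType")]
HB.structure Definition LieAlgebra (K : fieldType) :=
  { L of GRing.Lmodule K L & Lmodule_isLieAlgebra K L }.

Section LieModule.
Variables (K : fieldType) (L : lieAlgType K) (V : lmodType K).
Variable act : L -> V -> V.
Implicit Types (A : L -> Prop) (W : V -> Prop).

Definition lie_module : Prop :=
  [/\ forall v, linear (fun x => act x v),
      forall x, linear (act x)
    & forall x y v, act (lie x y) v = act x (act y v) - act y (act x v)].

Definition subspace W : Prop :=
  W 0 /\ forall a u w, W u -> W w -> W (a *: u + w).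

Definition submodule A W : Prop :=
  subspace W /\ forall x w, A x -> W w -> W (act x w).

Definition generated_submodule A (v : V) : V -> Prop :=
  fun w => forall W, submodule A W -> W v -> W w.

Definition simple_module : Prop :=
  [/\ lie_module, exists v : V, v <> 0
    & forall W, submodule (fun=> True) W ->
        (forall w, W w -> w = 0) \/ (forall w, W w)].

Definition finite_dimensional W : Prop :=
  exists n (s : 'I_n -> V), (forall k, W (s k)) /\
    forall w, W w -> exists c : 'I_n -> K, w = \sum_k c k *: s k.

Definition locally_nilpotent (x : L) : Prop :=
  forall v, exists m, (0 < m)%N /\ iter m (act x) v = 0.

End LieModule.

Definition span (K : fieldType) (V : lmodType K) (S : V -> Prop) : V -> Prop :=
  fun w => exists n (c : 'I_n -> K) (s : 'I_n -> V),
    (forall k, S (s k)) /\ w = \sum_k c k *: s k.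

(* Bilinear extension to the free modules on I and J of a map given on pairs  *)
(* of basis vectors.                                                          *)
Section BilinearExtension.
Variables (K : fieldType) (I J : choiceType) (V : lmodType K).
Variable f : I -> J -> V.

Definition bilin_ext (x : {malg K[I]}) (y : {malg K[J]}) : V :=
  \sum_(i <- msupp x) \sum_(j <- msupp y) (x@_i * y@_j) *: f i j.

Lemma bilin_extw (d1 : {fset I}) (d2 : {fset J}) x y :
  (msupp x `<=` d1)%fset -> (msupp y `<=` d2)%fset ->
  bilin_ext x y = \sum_(i <- d1) \sum_(j <- d2) (x@_i * y@_j) *: f i j.
Proof.
move=> le1 le2; rewrite /bilin_ext (big_fset_incl _ le1) /=.
  apply: eq_bigr => i _; apply: big_fset_incl => // j _ /mcoeff_outdom ->.
  by rewrite mulr0 scale0r.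
move=> i _ /mcoeff_outdom xi; rewrite big1 // => j _.
by rewrite xi mul0r scale0r.
Qed.

Lemma bilin_ext_linearl y : linear (fun x => bilin_ext x y).
Proof.
move=> a u v.
pose d := (msupp (a *: u + v) `|` (msupp u `|` msupp v))%fset.
have h1 : (msupp (a *: u + v) `<=` d)%fset by apply: fsubsetUl.
have h2 : (msupp u `<=` d)%fset.
  by apply: fsubset_trans (fsubsetUr _ _); apply: fsubsetUl.
have h3 : (msupp v `<=` d)%fset.
  by apply: fsubset_trans (fsubsetUr _ _); apply: fsubsetUr.
have h0 := fsubset_refl (msupp y).
rewrite (bilin_extw h1 h0) (bilin_extw h2 h0) (bilin_extw h3 h0).
rewrite scaler_sumr -big_split; apply: eq_bigr => i _ /=.
rewrite scaler_sumr -big_split; apply: eq_bigr => j _ /=.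
by rewrite mcoeffD mcoeffZ mulrDl scalerDl scalerA mulrA.
Qed.

Lemma bilin_ext_linearr x : linear (bilin_ext x).
Proof.
move=> a u v.
pose d := (msupp (a *: u + v) `|` (msupp u `|` msupp v))%fset.
have h1 : (msupp (a *: u + v) `<=` d)%fset by apply: fsubsetUl.
have h2 : (msupp u `<=` d)%fset.
  by apply: fsubset_trans (fsubsetUr _ _); apply: fsubsetUl.
have h3 : (msupp v `<=` d)%fset.
  by apply: fsubset_trans (fsubsetUr _ _); apply: fsubsetUr.
have h0 := fsubset_refl (msupp x).
rewrite (bilin_extw h0 h1) (bilin_extw h0 h2) (bilin_extw h0 h3).
rewrite scaler_sumr -big_split; apply: eq_bigr => i _ /=.
rewrite scaler_sumr -big_split; apply: eq_bigr => j _ /=.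
by rewrite mcoeffD mcoeffZ mulrDr scalerDl scalerA mulrCA.
Qed.

Lemma bilin_extU i j :
  bilin_ext (mkmalgU i 1) (mkmalgU j 1) = f i j.
Proof.
rewrite (bilin_extw msuppU_le msuppU_le) !big_seq_fset1.
by rewrite !mcoeffUU mulr1 scale1r.
Qed.

End BilinearExtension.

Section Heisenberg.
Variable R : realType.
Local Notation C := R[i].

Definition heisenberg : Type := {malg C[int]}.
HB.instance Definition _ := GRing.Lmodule.on heisenberg.

Definition z_ (i : int) : heisenberg := mkmalgU i 1.

Definition heis_bracket_basis (i j : int) : heisenberg :=
  if i == - j then j%:~R *: z_ 0 else 0.

Definition heis_bracket : heisenberg -> heisenberg -> heisenberg :=
  bilin_ext heis_bracket_basis.

Lemma heis_bracketE x y :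
  heis_bracket x y = (\sum_(i <- msupp x) \sum_(j <- msupp y)
    (x@_i * y@_j) * (if i == - j then j%:~R else 0)) *: z_ 0.
Proof.
rewrite scaler_suml; apply: eq_bigr => i _.
rewrite scaler_suml; apply: eq_bigr => j _.
rewrite /heis_bracket_basis; case: ifP => _; first by rewrite scalerA.
by rewrite scaler0 mulr0 scale0r.
Qed.

Lemma heis_bracket_linearl y : linear (fun x => heis_bracket x y).
Proof. exact: bilin_ext_linearl. Qed.

Lemma heis_bracket_linearr x : linear (heis_bracket x).
Proof. exact: bilin_ext_linearr. Qed.

Lemma heis_bracketxx x : heis_bracket x x = 0.
Proof.
rewrite heis_bracketE; set s := (X in X *: _).
suff -> : s = 0 by rewrite scale0r.
suff sN : s = - s.
  have: s *+ 2 == 0 by rewrite mulr2n {2}sN subrr.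
  by rewrite -mulr_natr mulf_eq0 pnatr_eq0 orbF => /eqP.
rewrite {1}/s exchange_big /= -sumrN; apply: eq_bigr => i _.
rewrite -sumrN; apply: eq_bigr => j _.
rewrite (mulrC x@_j) -mulrN; congr (_ * _).
rewrite [j == _]eq_sym eqr_oppLR; case: eqP => [->|_]; last by rewrite oppr0.
by rewrite rmorphN.
Qed.

Lemma heis_bracketz0 x a : heis_bracket x (a *: z_ 0) = 0.
Proof.
rewrite heis_bracketE big1 ?scale0r // => i _; rewrite big1 // => j _.
rewrite mcoeffZ mcoeffU; have [<-|_] := eqVneq 0 j; last first.
  by rewrite mulr0n !mulr0 mul0r.
by rewrite (_ : 0%:~R = 0) // if_same mulr0.
Qed.

Lemma heis_jacobi x y w :
  heis_bracket x (heis_bracket y w) + heis_bracket y (heis_bracket w x)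
    + heis_bracket w (heis_bracket x y) = 0.
Proof.
rewrite (heis_bracketE y) (heis_bracketE w) (heis_bracketE x y).
by rewrite !heis_bracketz0 !addr0.
Qed.

HB.instance Definition _ := Lmodule_isLieAlgebra.Build C heisenberg
  heis_bracket_linearl heis_bracket_linearr heis_bracketxx heis_jacobi.

Lemma lie_z_ i j : lie (z_ i) (z_ j) = heis_bracket_basis i j.
Proof. exact: bilin_extU. Qed.

Definition nplus : heisenberg -> Prop :=
  span (fun x => exists2 i : int, 0 < i & x = z_ i).

Definition highest_weight_module (V : lmodType C) (act : heisenberg -> V -> V) :=
  lie_module act /\
  exists v : V, [/\ v <> 0, forall x, nplus x -> act x v = 0,
    exists lambda : C, act (z_ 0) v = lambda *: v
    & forall w, generated_submodule act (fun=> True) v w].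

End Heisenberg.

Definition posn : Type := {n : nat | (0 < n)%N}.
HB.instance Definition _ := Choice.on posn.
HB.instance Definition _ := [isSub of posn for @sval _ _].

(* [posS n] is the positive integer n + 1. *)
Definition posS (n : nat) : posn := exist _ n.+1 isT.

(* The set I; the sequences are indexed by the positive integers. *)
Definition seqI : Type := {fsfun posn -> posn with posS 1}.
HB.instance Definition _ := Choice.on seqI.

Definition upd (e : seqI) (i n : posn) : seqI := [fsfun e with i |-> n].

Section Module.
Variable R : realType.
Local Notation C := R[i].

Definition modV : Type := {malg C[seqI]}.
HB.instance Definition _ := GRing.Lmodule.on modV.

Definition v_ (e : seqI) : modV := mkmalgU e 1.

(* [Posz k.+1] is k + 1, [Negz k] is - (k + 1); in both cases [posS k] is the *)
(* absolute value of i, and [posS n.-2] is n - 1 for n > 1.                   *)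
Definition z_on_basis (i : int) (e : seqI) : modV :=
  match i with
  | Posz 0 => v_ e
  | Posz k.+1 =>
      let n := val (e (posS k)) in
      if n == 1%N then 0 else v_ (upd e (posS k) (posS n.-2))
  | Negz k =>
      let n := val (e (posS k)) in
      (i%:~R * n%:R) *: v_ (upd e (posS k) (posS n))
  end.

Definition heis_act : heisenberg R -> modV -> modV := bilin_ext z_on_basis.

Lemma heis_actU i e : heis_act (z_ R i) (v_ e) = z_on_basis i e.
Proof. exact: bilin_extU. Qed.

End Module.

(* Main.v *)
(* Let k > 0. On coefficients, z_k shifts the k-th index, and z_(-k) z_k is   *)
(* diagonal in the basis v_e with eigenvalue - k (e_k - 1). These diagonal    *)
(* operators separate the basis vectors, so a nonzero submodule contains some *)
(* v_e, hence every v_e', which differs from it in finitely many places. If v *)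
(* is nonzero then, for k large, z_k v is nonzero and supported on sequences  *)
(* with k-th entry 1, so the vectors z_k v do not lie in a finite-dimensional *)
(* space.                                                                     *)

Require Import Defs.
From HB Require Import structures.
From mathcomp Require Import all_boot all_order all_algebra.
From mathcomp Require Import finmap complex reals.
From mathcomp.multinomials Require Import monalg.
From mathcomp Require Import boolp.

Set Implicit Arguments.
Unset Strict Implicit.
Unset Printing Implicit Defensive.

Import Order.TTheory GRing.Theory Num.Theory.
Local Open Scope ring_scope.

(** Each slot of a sequence carries a Fock space whose vacuum is the entry 1, and V is a tensor
    product of these whose reference vector has entry 2, an excited state, in almost every slot.
    Within a slot everything is as in Fock space, which gives the relations ([commutatorP]), local
    nilpotency and simplicity ([submodule_basis_vector], [submodule_full]). But a vector of V is
    excited in all slots far enough out, so no nonzero vector is killed by all of them, and lowering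
    far slots leaves any finite-dimensional space ([zpos_escapes]). *)

Section Linear.
Variables (K : fieldType) (U V : lmodType K).

Lemma linear_fun0 (f : U -> V) : linear f -> f 0 = 0.
Proof.
by move=> lf; rewrite -[0 in LHS](addNr 0) -scaleN1r lf scaleN1r addNr.
Qed.

Lemma linear_funZ (f : U -> V) a u : linear f -> f (a *: u) = a *: f u.
Proof. by move=> lf; rewrite -[a *: u]addr0 lf (linear_fun0 lf) addr0. Qed.

Lemma linear_comp (T : lmodType K) (f : V -> T) (g : U -> V) :
  linear f -> linear g -> linear (f \o g).
Proof. by move=> lf lg a u w /=; rewrite lg lf. Qed.

Lemma linear_sub (f g : U -> V) :
  linear f -> linear g -> linear (fun u => f u - g u).
Proof.
by move=> lf lg a u w; rewrite lf lg scalerBr opprD addrACA.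
Qed.

(** With [malg_subspace], this reduces an identity between linear maps to basis vectors. *)
Lemma subspace_eq (f g : U -> V) :
  linear f -> linear g -> subspace (fun u => f u = g u).
Proof.
move=> lf lg; split; first by rewrite !linear_fun0.
by move=> a u w fgu fgw; rewrite lf lg fgu fgw.
Qed.

Lemma subspace_sum (W : V -> Prop) (I : Type) (r : seq I) (F : I -> V) :
  subspace W -> (forall i, W (F i)) -> W (\sum_(i <- r) F i).
Proof.
move=> [W0 Wl] WF; apply: (big_ind W) => // u w Wu Ww.
by rewrite -[u]scale1r; apply: Wl.
Qed.

Lemma subspaceZ (W : V -> Prop) a u : subspace W -> W u -> W (a *: u).
Proof. by move=> [W0 Wl] Wu; rewrite -[a *: u]addr0; apply: Wl. Qed.

End Linear.

Lemma linear_malg_coeff (K : fieldType) (I : choiceType) (i : I) :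
  linear (fun x : {malg K[I]} => x@_i : K^o).
Proof. by move=> a u w; rewrite mcoeffD mcoeffZ. Qed.

Lemma malg_subspace (K : fieldType) (I : choiceType) (W : {malg K[I]} -> Prop) :
  subspace W -> (forall i, W (mkmalgU i 1)) -> forall x, W x.
Proof.
move=> sW WU x; rewrite [x]monalgE; apply: subspace_sum => // i.
suff -> : mkmalgU i x@_i = x@_i *: mkmalgU i 1 by apply: subspaceZ.
by apply/malgP => j; rewrite mcoeffZ !mcoeffU mulrnAr mulr1.
Qed.

Lemma span_mem (K : fieldType) (V : lmodType K) (S : V -> Prop) x :
  S x -> Defs.span S x.
Proof.
move=> Sx; exists 1%N, (fun=> 1), (fun=> x); split=> //.
by rewrite big_ord1 scale1r.
Qed.

(** * Sequences and their shifted entries *)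

(* [ent e k] is [e_(k+1) - 1], so that [ent] takes all natural values. *)
Definition ent (e : seqI) (k : nat) : nat := (val (e (posS k))).-1.

Definition set_ent (e : seqI) (k n : nat) : seqI := upd e (posS k) (posS n).

Lemma val_entE (e : seqI) k : val (e (posS k)) = (ent e k).+1.
Proof. by rewrite prednK //; apply: valP. Qed.

Lemma ent_set e k n l : ent (set_ent e k n) l = if l == k then n else ent e l.
Proof.
rewrite /ent /set_ent /upd fsfun_withE.
by rewrite -val_eqE /= eqSS; case: eqP.
Qed.

Lemma ent_inj e e' : ent e =1 ent e' -> e = e'.
Proof.
move=> ee; apply/fsfunP => p; have -> : p = posS (val p).-1.
  by apply: val_inj; rewrite /= prednK //; apply: valP.
by apply: val_inj; rewrite !val_entE ee.
Qed.

Lemma set_entK e k n m : set_ent (set_ent e k n) k m = set_ent e k m.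
Proof. by apply: ent_inj => l; rewrite !ent_set; case: eqP. Qed.

Lemma set_ent_id e k : set_ent e k (ent e k) = e.
Proof. by apply: ent_inj => l; rewrite !ent_set; case: eqP => // ->. Qed.

Lemma set_entC e k l n m : k != l ->
  set_ent (set_ent e k n) l m = set_ent (set_ent e l m) k n.
Proof.
move=> kl; apply: ent_inj => p; rewrite !ent_set.
by have [->|] := eqVneq p l => //; rewrite eq_sym (negPf kl).
Qed.

(** Beyond all the finite supports every entry has its default value 2, which [ent] reads as 1. *)
Lemma eventually_ent1 (s : seq seqI) :
  exists N, forall i e, (N <= i)%N -> e \in s -> ent e i = 1%N.
Proof.
exists (\max_(e <- s) \max_(p <- finsupp e) val p) => i e le_i es.
rewrite /ent fsfun_dflt //; apply/negP => ie; move: le_i; apply/negP.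
rewrite -ltnNge; apply: leq_trans (leq_bigmax_seq _ es isT).
exact: (@leq_bigmax_seq _ _ xpredT (fun p : posn => val p) _ ie isT).
Qed.

(** * Coefficients of the action *)

Section Action.
Variable R : realType.
Local Notation C := R[i]%C.
Local Notation act := (@heis_act R).
Local Notation z_ := (z_ R).
Local Notation v_ := (v_ R).
Implicit Types (e : seqI) (v : modV R).

Lemma heis_act_linearl v : linear (fun x => act x v).
Proof. exact: bilin_ext_linearl. Qed.

Lemma heis_act_linearr x : linear (act x).
Proof. exact: bilin_ext_linearr. Qed.

Lemma modV_eqP v w : (forall e, v@_e = w@_e) -> v = w.
Proof. by move=> vw; apply/malgP. Qed.

Lemma coeffB v w e : (v - w)@_e = v@_e - w@_e.
Proof. exact: mcoeffB. Qed.

Lemma coeffZ (a : C) v e : (a *: v)@_e = a * v@_e.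
Proof. exact: mcoeffZ. Qed.

Lemma coeff0 e : (0 : modV R)@_e = 0.
Proof. exact: mcoeff0. Qed.

Lemma coeff_neq0 v : v <> 0 -> exists e, v@_e != 0.
Proof.
apply: contra_notP => ve; apply: modV_eqP => e; rewrite coeff0.
by apply: contrapT => /eqP ve0; apply: ve; exists e.
Qed.

Lemma z_on_basis_pos k e : z_on_basis R k.+1 e =
  if ent e k is n.+1 then v_ (set_ent e k n) else 0.
Proof. by rewrite /z_on_basis val_entE; case: (ent e k). Qed.

Lemma z_on_basis_neg k e : z_on_basis R (Negz k) e =
  ((Negz k)%:~R * (ent e k).+1%:R) *: v_ (set_ent e k (ent e k).+1).
Proof. by rewrite /z_on_basis val_entE. Qed.

Lemma act_z0 v : act (z_ 0) v = v.
Proof.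
have lid : linear (@id (modV R)) by [].
apply: (malg_subspace (subspace_eq (heis_act_linearr (z_ 0)) lid)) => e.
exact: heis_actU.
Qed.

(** Exactly one basis vector is lowered to [v_ e]: the one whose entry at [k] is larger by one. *)
Lemma coeff_zpos k v e :
  (act (z_ k.+1) v)@_e = v@_(set_ent e k (ent e k).+1).
Proof.
move: v; apply: malg_subspace => [|d].
  apply: subspace_eq; last exact: linear_malg_coeff.
  exact: linear_comp (linear_malg_coeff e) (heis_act_linearr (z_ k.+1)).
rewrite [act _ _]heis_actU z_on_basis_pos mcoeffU.
case dk: (ent d k) => [|n].
  rewrite mcoeff0; case: eqP => // de.
  by move: dk; rewrite de ent_set eqxx.
rewrite mcoeffU; congr (_ *+ nat_of_bool _); apply/eqP/eqP => [<-|de].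
  by rewrite ent_set eqxx set_entK -dk set_ent_id.
suff -> : n = ent e k by rewrite de set_entK set_ent_id.
by move: dk; rewrite de ent_set eqxx => -[].
Qed.

(** The scalar is the one attached to the entry before raising. If [ent e k] is 0, nothing is raised
    to [v_ e]; the factor then vanishes, so the truncated predecessor is harmless. *)
Lemma coeff_zneg k v e : (act (z_ (Negz k)) v)@_e =
  (Negz k)%:~R * (ent e k)%:R * v@_(set_ent e k (ent e k).-1).
Proof.
move: v; apply: malg_subspace => [|d].
  apply: (@subspace_eq _ _ (C^o)).
    exact: linear_comp (linear_malg_coeff e) (heis_act_linearr _).
  by move=> a u w; rewrite mcoeffD mcoeffZ mulrDr mulrCA.
rewrite [act _ _]heis_actU z_on_basis_neg mcoeffZ !mcoeffU.
have [->|ed] := eqVneq e (set_ent d k (ent d k).+1).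
  by rewrite ent_set !eqxx /= set_entK set_ent_id eqxx.
rewrite mulr0.
case ek: (ent e k) => [|n]; first by rewrite mulr0 mul0r.
case: eqP => [de|]; last by rewrite mulr0.
case/eqP: ed; rewrite de ent_set eqxx set_entK /= -ek set_ent_id.
by [].
Qed.

(** * Commutation relations *)

(* [A i] is the action of [z_i], kept abstract because rewriting with the     *)
(* coefficient formulas diverges once [heis_act] can be unfolded.             *)
Section AbstractAction.
Variable A : int -> modV R -> modV R.
Hypothesis A0 : forall v, A 0 v = v.
Hypothesis coeff_pos : forall k v e,
  (A k.+1 v)@_e = v@_(set_ent e k (ent e k).+1).
Hypothesis coeff_neg : forall k v e, (A (Negz k) v)@_e =
  (Negz k)%:~R * (ent e k)%:R * v@_(set_ent e k (ent e k).-1).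

Lemma coeff_negpos k v e :
  (A (Negz k) (A k.+1 v))@_e = (Negz k)%:~R * (ent e k)%:R * v@_e.
Proof.
rewrite coeff_neg coeff_pos ent_set eqxx set_entK.
case ek: (ent e k) => [|n]; first by rewrite mulr0 !mul0r.
by rewrite /= -ek set_ent_id.
Qed.

Lemma coeff_iter_pos m k v e :
  (iter m (A k.+1) v)@_e = v@_(set_ent e k (ent e k + m)).
Proof.
elim: m e => [|m IH] e; first by rewrite addn0 set_ent_id.
by rewrite iterS coeff_pos IH ent_set eqxx set_entK addSnnS.
Qed.

Definition commutator (i j : int) : Prop := forall v,
  (if i == - j then j%:~R else 0) *: v =
  A i (A j v) - A j (A i v).

Lemma commutatorC i j : commutator i j -> commutator j i.
Proof.
move=> cij v; rewrite -[RHS]opprB -cij -scaleNr; congr (_ *: _).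
rewrite -eqr_oppLR eq_sym.
case: eqP => [->|_]; last by rewrite oppr0.
by rewrite rmorphN.
Qed.

Lemma commutator0 j : commutator 0 j.
Proof.
move=> v; rewrite !A0 subrr eq_sym oppr_eq0.
by case: eqP => [->|_]; rewrite scale0r.
Qed.

Lemma commutator_pos k l : commutator k.+1 l.+1.
Proof.
move=> v; rewrite scale0r; apply: modV_eqP => e.
rewrite coeff0 coeffB !coeff_pos !ent_set.
have [->|kl] := eqVneq l k; first by rewrite subrr.
by rewrite set_entC 1?eq_sym // subrr.
Qed.

Lemma commutator_neg k l : commutator (Negz k) (Negz l).
Proof.
move=> v; rewrite scale0r; apply: modV_eqP => e.
rewrite coeff0 coeffB !coeff_neg !ent_set.
have [->|kl] := eqVneq l k; first by rewrite subrr.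
by rewrite set_entC 1?eq_sym // mulrCA subrr.
Qed.

(** In one slot the two orders give the factors [ent e k + 1] and [ent e k], whose difference is 1;
    operators on distinct slots commute. *)
Lemma commutator_posneg k l : commutator k.+1 (Negz l).
Proof.
move=> v; apply: modV_eqP => e; rewrite coeffB coeffZ.
have [<-|kl] := eqVneq k l.
  rewrite coeff_negpos coeff_pos coeff_neg ent_set eqxx set_entK set_ent_id.
  by rewrite NegzE opprK eqxx -mulrBl -mulrBr -natrB // subSnn mulr1.
rewrite coeff_pos !coeff_neg coeff_pos !ent_set.
rewrite [l == k]eq_sym (negPf kl) set_entC // subrr NegzE opprK.
by rewrite eqz_nat eqSS (negPf kl) mul0r.
Qed.

Lemma commutatorP i j : commutator i j.
Proof.
case: i => [[|k]|k]; first exact: commutator0.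
  case: j => [[|l]|l]; last exact: commutator_posneg.
    exact/commutatorC/commutator0.
  exact: commutator_pos.
case: j => [[|l]|l]; last exact: commutator_neg.
  exact/commutatorC/commutator0.
exact/commutatorC/commutator_posneg.
Qed.

End AbstractAction.

Lemma heis_lie_module : lie_module act.
Proof.
split; [exact: heis_act_linearl | exact: heis_act_linearr |].
move=> x y v; move: x; apply: malg_subspace => [|i].
  apply: subspace_eq.
    exact: linear_comp (heis_act_linearl v) (@lie_linearl _ _ y).
  apply: linear_sub; first exact: heis_act_linearl.
  exact: linear_comp (heis_act_linearr y) (heis_act_linearl v).
move: y; apply: malg_subspace => [|j].
  apply: subspace_eq.
    exact: linear_comp (heis_act_linearl v) (@lie_linearr _ _ (z_ i)).
  apply: linear_sub; last exact: heis_act_linearl.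
  exact: linear_comp (heis_act_linearr (z_ i)) (heis_act_linearl v).
refine (etrans _ (@commutatorP (act \o z_) _ _ _ i j v));
  [|exact: act_z0|exact: coeff_zpos|exact: coeff_zneg].
rewrite [lie _ _]lie_z_ /heis_bracket_basis.
case: eqP => _.
  by rewrite (linear_funZ _ _ (heis_act_linearl v)) act_z0.
by rewrite scale0r (linear_fun0 (heis_act_linearl v)).
Qed.

(** * Local nilpotency and the action of [nplus] *)

Lemma zpos_locally_nilpotent k : locally_nilpotent act (z_ k.+1).
Proof.
(* [m] exceeds every entry at [k] in the support, so the [m]-th power reads coefficients outside the
   support. *)
move=> v; pose m := (\max_(d <- msupp v) ent d k).+1; exists m; split=> //.
apply: modV_eqP => e; rewrite coeff0.
rewrite (@coeff_iter_pos (act \o z_) coeff_zpos); apply: mcoeff_outdom.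
apply/negP => es; have := @leq_bigmax_seq _ _ xpredT (ent^~ k) _ es isT.
by rewrite ent_set eqxx leqNgt /m addnS ltnS leq_addl.
Qed.

(** Take [d] in the support of [v] and a slot [N] where [d] and all of [s] have [ent] equal to 1.
    Lowering there yields a term with [ent] equal to 0, which [s] cannot contain. *)
Lemma zpos_escapes v (s : seq seqI) : v <> 0 ->
  exists k e, e \notin s /\ (act (z_ k.+1) v)@_e != 0.
Proof.
move=> /coeff_neq0 [d dv].
have [N N1] := eventually_ent1 (d :: s).
exists N, (set_ent d N 0); split.
  apply/negP => ds; have := N1 N _ (leqnn N) (mem_behead (s := d :: s) ds).
  by rewrite ent_set eqxx.
rewrite coeff_zpos ent_set eqxx set_entK.
by rewrite -(N1 N d (leqnn N) (mem_head _ _)) set_ent_id.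
Qed.

Lemma nplus_zpos k : nplus (z_ k.+1).
Proof. by apply: span_mem; exists k.+1. Qed.

Lemma nplus_infinite_dimensional v : v <> 0 ->
  ~ finite_dimensional (generated_submodule act (@nplus R) v).
Proof.
move=> v0 [n [s [_ sP]]].
(* The list to escape is the union of the supports of a finite spanning family. *)
have [k [e [es ve]]] :=
  zpos_escapes (flatten [seq enum_fset (msupp (s j)) | j <- enum 'I_n]) v0.
have /sP [c vE] : generated_submodule act (@nplus R) v (act (z_ k.+1) v).
  by move=> W [_ WA] Wv; apply: WA Wv; apply: nplus_zpos.
case/eqP: ve; rewrite vE.
rewrite (raddf_sum (mcoeff e)) big1 // => j _ /=.
rewrite (coeffZ (c j) (s j)) mcoeff_outdom ?mulr0 //; apply: contra es => es.
by apply/flatten_mapP; exists j; rewrite ?mem_enum.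
Qed.

Lemma no_singular_vector :
  ~ exists v, v <> 0 /\ forall x, nplus x -> act x v = 0.
Proof.
move=> [v [v0 nv]]; have [k [e [_ /eqP]]] := zpos_escapes [::] v0.
by rewrite nv ?coeff0 //; apply: nplus_zpos.
Qed.

(** * Simplicity *)

Section Submodule.
Variable W : modV R -> Prop.
Hypothesis sW : submodule act (fun=> True) W.

Let W_subspace : subspace W. Proof. by case: sW. Qed.

Let W_act x w : W w -> W (act x w).
Proof. by case: sW => _ WA; apply: WA. Qed.

(* Distinct basis vectors are separated by the eigenvalues of some            *)
(* [z_(-k) z_k], so a multiple of w subtracted from [z_(-k) z_k w] kills one  *)
(* term of w and keeps another one.                                           *)
Lemma submodule_basis_vector w : W w -> w <> 0 -> exists e, W (v_ e).
Proof.
have [n] := ubnP #|` msupp w|; elim: n w => // n IH w; rewrite ltnS => le_n.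
move=> Ww /coeff_neq0 [e]; rewrite mcoeff_neq0 => ew.
have [[e' [e'w ee']]|only_e] := EM (exists e', e' \in msupp w /\ e' <> e).
  have [k kee'] : exists k, ent e' k <> ent e k.
    by apply/existsNP => ee; apply: ee'; apply: ent_inj.
  pose c : C := (Negz k)%:~R.
  pose u := - (c * (ent e k)%:R) *: w + act (z_ (Negz k)) (act (z_ k.+1) w).
  have uE d : u@_d = c * ((ent d k)%:R - (ent e k)%:R) * w@_d.
    rewrite mcoeffD (@coeff_negpos (act \o z_) coeff_zpos coeff_zneg).
    by rewrite coeffZ -/c mulrBr mulrBl mulNr addrC.
  have Wu : W u by apply: W_subspace.2 => //; do 2!apply: W_act.
  apply: IH Wu _.
    apply: leq_trans le_n; apply: fproper_ltn_card.
    rewrite fproperE; apply/andP; split.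
      apply/fsubsetP => d; rewrite -!mcoeff_neq0 uE.
      by apply: contra => /eqP ->; rewrite mulr0.
    apply/negP => /fsubsetP /(_ e ew).
    by rewrite -mcoeff_neq0 uE subrr mulr0 mul0r eqxx.
  move=> u0; have /eqP := uE e'; rewrite u0 coeff0 eq_sym !mulf_eq0.
  rewrite intr_eq0 /= subr_eq0 eqr_nat => /orP[/eqP//|].
  by apply/negP; rewrite mcoeff_neq0.
exists e.
have -> : v_ e = (w@_e)^-1 *: w; last exact: subspaceZ.
apply: modV_eqP => d; rewrite coeffZ mcoeffU.
have [<-|ed] := eqVneq e d; first by rewrite mulVf // mcoeff_neq0.
have [dw|/mcoeff_outdom ->] := boolP (d \in msupp w); last by rewrite mulr0.
by case: only_e; exists d; split=> // de; rewrite de eqxx in ed.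
Qed.

(** Lower the entry to the vacuum, then raise it to [n]; each raising scalar is nonzero in
    characteristic 0. *)
Lemma submodule_set_ent e k n : W (v_ e) -> W (v_ (set_ent e k n)).
Proof.
move=> We; elim: n => [|n IH].
  have [m] : exists m, ent e k = m by exists (ent e k).
  elim: m e We => [|m IH] e We em; first by rewrite -em set_ent_id.
  rewrite -(set_entK e k m 0); apply: IH; last by rewrite ent_set eqxx.
  by have := W_act (z_ k.+1) We; rewrite heis_actU z_on_basis_pos em.
have := W_act (z_ (Negz k)) IH; rewrite heis_actU z_on_basis_neg.
rewrite ent_set eqxx set_entK; set c : C := _ * _ => Wc.
suff c0 : c != 0.
  by rewrite -[v_ _](scalerK c0); apply: subspaceZ.
by rewrite mulf_neq0 // ?intr_eq0 ?pnatr_eq0.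
Qed.

(** Two sequences agree from some [N] on; correcting the slots below [N] one at a time, from the top
    down, turns [e] into [e']. *)
Lemma submodule_full e : W (v_ e) -> forall w, W w.
Proof.
move=> We; apply: malg_subspace => // e'.
have [N N1] := eventually_ent1 [:: e; e'].
have : forall i, (N <= i)%N -> ent e i = ent e' i.
  by move=> i iN; rewrite !(N1 i) // !inE eqxx ?orbT.
elim: N e We {N1} => [|N IH] e We ee.
  by rewrite -(_ : e = e') //; apply: ent_inj => i; apply: ee.
apply: (IH (set_ent e N (ent e' N))) => [|i iN].
  exact: submodule_set_ent.
rewrite ent_set; have [->//|iN'] := eqVneq i N.
by apply: ee; rewrite ltn_neqAle eq_sym iN' iN.
Qed.

End Submodule.

Lemma heis_simple_module : simple_module act.
Proof.
split; first exact: heis_lie_module.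
  exists (v_ [fsfun]); move=> /(congr1 (mcoeff [fsfun])).
  by rewrite mcoeffUU coeff0 => /eqP; rewrite oner_eq0.
move=> W sW; have [[w [Ww w0]]|W0] := EM (exists w, W w /\ w <> 0).
  by right; have [e We] := submodule_basis_vector sW Ww w0;
    apply: submodule_full We.
by left=> w Ww; apply: contrapT => w0; apply: W0; exists w.
Qed.

End Action.

Theorem mainTheorem3 (R : realType) :
  simple_module (@heis_act R) /\
  (forall i : int, 0 < i -> locally_nilpotent (@heis_act R) (z_ R i)) /\
  (forall v : modV R, v <> 0 ->
     ~ finite_dimensional (generated_submodule (@heis_act R) (@nplus R) v)) /\
  (~ exists v : modV R,
       v <> 0 /\ forall x, nplus x -> heis_act x v = 0) /\
  ~ highest_weight_module (@heis_act R).
Proof.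
split; first exact: heis_simple_module.
split; first by move=> [[|k]|k] // _; apply: zpos_locally_nilpotent.
split; first exact: nplus_infinite_dimensional.
split; first exact: no_singular_vector.
move=> [_ [v [v0 nv _ _]]].
by apply: (@no_singular_vector R); exists v.
Qed.
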